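(* For every integer $n\ge1$, the weak competitive ratio of the Simple Random Transaction algorithm $\mathrm{ALG}$ for SPVT described in the context equals $2$, i.e. $$\max_{\boldsymbol X}\frac{\mathrm{OPT}(\boldsymbol X)}{\mathrm{ALG}(\boldsymbol X)}=2,$$ where $\boldsymbol X=(X_1,\dots,X_{n+1})$ ranges over vectors of pairwise distinct non-negative prices and $\mathrm{OPT}$ is the weak offline optimum.
   Context: SPVT (secretary problem variant trading): there are $n$ buyers with non-negative prices $X_1,\dots,X_n$ and one seller with non-negative price $X_{n+1}$ (together: $n+1$ agents); all prices are assumed pairwise distinct. The seller initially holds one item; the intermediary and the buyers hold none. The agents arrive one by one in a uniformly random order; on arrival an agent reveals its price and whether it is a buyer or the seller. On each arrival the intermediary must immediately and irrevocably decide whether to trade: it may buy the item from the seller when the seller arrives, and it may sell the item to an arriving buyer only if it currently holds it. The social welfare is the price of the agent finally holding the item ($0$ if the intermediary ends up with it). $\mathrm{ALG}(\boldsymbol X)$ is the expected social welfare of the algorithm (over the random order and the algorithm's randomness). Weak offline optimum: for each arrival order, the offline algorithm knows the order and all prices in advance and makes the best feasible decisions for that order (it obtains the maximum of $X_{n+1}$ and the prices of the buyers arriving after the seller); $\mathrm{OPT}(\boldsymbol X)$ is the expectation of this optimum over the $(n+1)!$ equally likely orders. The weak competitive ratio is the maximum of $\mathrm{OPT}(\boldsymbol X)/\mathrm{ALG}(\boldsymbol X)$ over $\boldsymbol X$. Simple Random Transaction algorithm. When the seller arrives: if the seller's price is not the highest price among all agents that have arrived so far (including the seller), buy the item; otherwise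 buy it with probability $1/2$ (and do not buy with probability $1/2$). When a buyer arrives whose price is the highest among all agents (buyers and seller) that have arrived so far, sell the item to this buyer if the intermediary currently holds it. No other trades are made. *)

(* Defs.v *)
From mathcomp Require Import all_boot all_order all_algebra all_fingroup.

Set Implicit Arguments.
Unset Strict Implicit.
Unset Printing Implicit Defensive.

Import Order.TTheory GRing.Theory Num.Theory.
Local Open Scope ring_scope.

(* Agents are 'I_n.+1: the indices 0, ..., n.-1 are the n buyers and ord_max is
   the seller.  An arrival order is s : 'S_n.+1, where s t is the agent that
   arrives at time t. *)
Definition seller {n : nat} : 'I_n.+1 := ord_max.

Definition admissible {R : realFieldType} {n : nat} (X : 'I_n.+1 -> R) : Prop :=
  injective X /\ (forall i, 0 <= X i).

(* The agent holding the item; None is the intermediary. *)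
Definition holder (n : nat) : Type := option 'I_n.+1.

(* The holder after the arrival of agent a, where d tells whether the
   intermediary wants to trade with a; an infeasible trade has no effect. *)
Definition step {n : nat} (h : holder n) (a : 'I_n.+1) (d : bool) : holder n :=
  if d then
    if a == seller then (if h == Some seller then None else h)
    else (if h == None then Some a else h)
  else h.

(* d t is the decision taken at time t; enum 'I_n.+1 is 0, 1, ..., n. *)
Definition final_holder {n : nat} (s : 'S_n.+1) (d : {ffun 'I_n.+1 -> bool}) :
    holder n :=
  foldl (fun h t => step h (s t) (d t)) (Some seller) (enum 'I_n.+1).

Definition welfare {R : realFieldType} {n : nat} (X : 'I_n.+1 -> R)
    (h : holder n) : R :=
  if h is Some a then X a else 0.

Definition uniform_order_mean {R : realFieldType} {n : nat}
    (f : 'S_n.+1 -> R) : R :=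
  (\sum_(s : 'S_n.+1) f s) / (n.+1)`!%:R.

(* Welfare is non-negative for admissible prices, so the default value 0 of the
   maximum is harmless. *)
Definition offline_opt {R : realFieldType} {n : nat} (X : 'I_n.+1 -> R)
    (s : 'S_n.+1) : R :=
  \big[Num.max/0]_(d : {ffun 'I_n.+1 -> bool}) welfare X (final_holder s d).

Definition OPT {R : realFieldType} {n : nat} (X : 'I_n.+1 -> R) : R :=
  uniform_order_mean (offline_opt X).

Definition highest_so_far {R : realFieldType} {n : nat} (X : 'I_n.+1 -> R)
    (s : 'S_n.+1) (t : 'I_n.+1) : bool :=
  [forall u : 'I_n.+1, (u <= t)%N ==> (X (s u) <= X (s t))].

(* Simple Random Transaction.  There is only one seller, so a single fair coin
   (true: buy) accounts for all the randomness of the algorithm. *)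
Definition srt_decision {R : realFieldType} {n : nat} (X : 'I_n.+1 -> R)
    (s : 'S_n.+1) (coin : bool) : {ffun 'I_n.+1 -> bool} :=
  [ffun t => if s t == seller then ~~ highest_so_far X s t || coin
             else highest_so_far X s t].

Definition srt_welfare {R : realFieldType} {n : nat} (X : 'I_n.+1 -> R)
    (s : 'S_n.+1) (coin : bool) : R :=
  welfare X (final_holder s (srt_decision X s coin)).

Definition SRT {R : realFieldType} {n : nat} (X : 'I_n.+1 -> R) : R :=
  uniform_order_mean
    (fun s => (srt_welfare X s true + srt_welfare X s false) / 2).

(* c is the maximum of OPT X / ALG X over the admissible X.  Positivity of ALG X
   is required because division by 0 returns 0 in MathComp, so that a bound on
   the quotient alone would say nothing about an X with ALG X = 0. *)
Definition is_weak_competitive_ratio {R : realFieldType} {n : nat}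
    (ALG : ('I_n.+1 -> R) -> R) (c : R) : Prop :=
  (exists X : 'I_n.+1 -> R,
     [/\ admissible X, 0 < ALG X & OPT X / ALG X = c]) /\
  (forall X : 'I_n.+1 -> R, admissible X ->
     0 < ALG X /\ OPT X / ALG X <= c).

(* Main.v *)
(* For every price vector the ratio is exactly 2; more precisely each agent a
   ends up with the item half as often under the algorithm as under the offline
   optimum.  The offline optimum gives the item to a when a is the best agent
   among those arriving from the seller on.  A buyer a receives it from the
   algorithm only if a is a record arriving after the seller; given this, and
   given the best agent b arriving before a, it receives the item with
   probability 1 if b precedes the seller, 1/2 if b is the seller and 0 if b
   follows the seller, and exchanging the arrival times of b and the seller
   shows that the average is 1/2.  Reversing time and exchanging a with the
   seller maps the orders in which a is a record after the seller onto those in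
   which a is the offline choice.  For the seller, reversing time suffices. *)

Require Import Defs.
From mathcomp Require Import all_boot all_order all_algebra all_fingroup.

Set Implicit Arguments.
Unset Strict Implicit.
Unset Printing Implicit Defensive.

Import Order.TTheory GRing.Theory Num.Theory.

Local Open Scope ring_scope.

(** * Where the item ends up under given decisions *)

Lemma pairwise_enum_ord (m : nat) :
  pairwise (fun i j : 'I_m => (i < j)%N) (enum 'I_m).
Proof.
rewrite -(pairwise_map val ltn) val_enum_ord.
by rewrite -(sorted_pairwise ltn_trans) iota_ltn_sorted.
Qed.

Lemma ohead_filter_enum_ord (m : nat) (P : pred 'I_m) (q : 'I_m) :
  (ohead [seq t <- enum 'I_m | P t] == Some q) =
  P q && [forall u : 'I_m, (u < q)%N ==> ~~ P u].
Proof.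
have memE u : (u \in [seq t <- enum 'I_m | P t]) = P u.
  by rewrite mem_filter mem_enum andbT.
have := pairwise_filter P (pairwise_enum_ord m).
case: [seq t <- enum 'I_m | P t] memE => [|x r] memE /=.
  by move=> _; rewrite -memE.
move=> /andP[/allP ltx _].
apply/eqP/andP => [[<-]|[Pq /forallP minq]].
  split; first by rewrite -memE mem_head.
  apply/forallP => u; apply/implyP => ux; rewrite -memE inE negb_or.
  rewrite neq_ltn ux /=; apply/negP => /ltx xu.
  by have := ltn_trans ux xu; rewrite ltnn.
move: Pq; rewrite -memE inE => /orP[/eqP-> //|/ltx xq].
by have /implyP/(_ xq) := minq x; rewrite -memE mem_head.
Qed.

Lemma foldl_step_held (n : nat) (s : 'S_n.+1) (d : {ffun 'I_n.+1 -> bool}) a r :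
  {in r, forall t, s t != seller} ->
  foldl (fun h t => step h (s t) (d t)) (Some a) r = Some a.
Proof.
elim: r => //= t r IH notS.
rewrite {2}/step (negPf (notS t (mem_head _ _))) if_same.
by apply: IH => u ur; apply: notS; rewrite inE ur orbT.
Qed.

Lemma foldl_step_free (n : nat) (s : 'S_n.+1) (d : {ffun 'I_n.+1 -> bool}) r :
  {in r, forall t, s t != seller} ->
  foldl (fun h t => step h (s t) (d t)) None r =
  omap s (ohead [seq t <- r | d t]).
Proof.
elim: r => //= t r IH notS.
have notSr : {in r, forall t, s t != seller}.
  by move=> u ur; apply: notS; rewrite inE ur orbT.
rewrite {2}/step (negPf (notS t (mem_head _ _))) /=.
by case: (d t) => /=; [apply: foldl_step_held | apply: IH].
Qed.

(** Until time [p] the seller holds the item, so no trade is feasible. If it is bought at [p], the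
    first later buyer whose decision is [true] takes it for good. *)
Lemma final_holderE (n : nat) (s : 'S_n.+1) (d : {ffun 'I_n.+1 -> bool})
    (p : 'I_n.+1) :
  s p = seller ->
  final_holder s d =
  if d p then omap s (ohead [seq t : 'I_n.+1 <- enum 'I_n.+1 | (p < t)%N && d t])
  else Some seller.
Proof.
move=> sp; rewrite /final_holder.
have psE t : (s t == seller) = (t == p).
  by rewrite -sp (inj_eq (@perm_inj _ s)).
have : p \in enum 'I_n.+1 by rewrite mem_enum.
move: (enum _) (pairwise_enum_ord n.+1) => r lt_r pr.
case/splitPr: pr lt_r => r1 r2.
rewrite pairwise_cat /= => /and3P[/allrelP lt12 _ /andP[/allP lt2 _]].
have lt1 (t : 'I_n.+1) : t \in r1 -> (t < p)%N.
  by move=> tr; apply: lt12; rewrite ?mem_head.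
rewrite foldl_cat foldl_step_held /=; last first.
  by move=> t /lt1 tp; rewrite psE neq_ltn tp.
have notS2 : {in r2, forall t, s t != seller}.
  by move=> t /lt2 pt; rewrite psE neq_ltn pt orbT.
rewrite filter_cat /= ltnn /=.
rewrite (_ : [seq t : 'I_n.+1 <- r1 | (p < t)%N && d t] = [::]) /=; last first.
  apply/eqP; rewrite -[_ == _]negbK -has_filter; apply/hasPn => t /lt1 tp.
  by rewrite negb_and -leqNgt (ltnW tp).
rewrite {2}/step sp !eqxx; case: (d p); last exact: foldl_step_held.
rewrite foldl_step_free //; congr (omap _ (ohead _)).
by apply: eq_in_filter => t /lt2 ->.
Qed.

(* A permutation s of arrivals is described by its inverse sg, mapping an agent
   to its arrival time. *)
Lemma final_holder_seller (n : nat) (sg : 'S_n.+1) (d : {ffun 'I_n.+1 -> bool}) :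
  (final_holder sg^-1%g d == Some seller) = ~~ d (sg seller).
Proof.
rewrite (@final_holderE _ _ _ (sg seller)) ?permK //.
case: (d _); last by rewrite eqxx.
apply/eqP; case E: (ohead _) => [t|] //= [tS].
have /eqP := E; rewrite ohead_filter_enum_ord => /andP[/andP[]].
by rewrite -tS permKV ltnn.
Qed.

Lemma final_holder_buyer (n : nat) (sg : 'S_n.+1) (d : {ffun 'I_n.+1 -> bool}) a :
  a != seller ->
  (final_holder sg^-1%g d == Some a) =
  [&& d (sg seller), (sg seller < sg a)%N, d (sg a) &
   [forall c, (sg seller < sg c < sg a)%N ==> ~~ d (sg c)]].
Proof.
move=> aS; rewrite (@final_holderE _ _ _ (sg seller)) ?permK //.
case: (d (sg seller)) => /=; last first.
  by apply/negbTE; rewrite eq_sym; apply: contra aS => /eqP[->].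
have -> o : (omap sg^-1%g o == Some a) = (o == Some (sg a)).
  case: o => //= t.
  by rewrite !(inj_eq Some_inj) -(inj_eq (@perm_inj _ sg)) permKV.
rewrite ohead_filter_enum_ord -andbA; congr [&& _, _ & _].
apply/forallP/forallP => free c.
  have := free (sg c); case: (sg c < _)%N; last by rewrite andbF.
  by rewrite andbT negb_and; case: (_ < _)%N.
have := free (sg^-1%g c); rewrite permKV.
by do 2!case: (_ < _)%N.
Qed.

(** * Best agents and the offline optimum *)

Definition best_among {R : realFieldType} {n : nat} (X : 'I_n.+1 -> R)
    (P : pred 'I_n.+1) (a : 'I_n.+1) : bool :=
  P a && [forall c, P c ==> (X c <= X a)].

Lemma best_amongP (R : realFieldType) (n : nat) (X : 'I_n.+1 -> R)
    (P : pred 'I_n.+1) a :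
  reflect (P a /\ forall c, P c -> X c <= X a) (best_among X P a).
Proof.
apply: (iffP andP) => [[Pa /forallP maxa]|[Pa maxa]].
  by split=> // c Pc; have /implyP := maxa c; apply.
by split=> //; apply/forallP => c; apply/implyP; apply: maxa.
Qed.

Lemma best_among_ex (R : realFieldType) (n : nat) (X : 'I_n.+1 -> R)
    (P : pred 'I_n.+1) i :
  injective X -> P i -> exists b, best_among X P =1 pred1 b.
Proof.
move=> injX Pi; case: (@arg_maxP _ _ _ i P X Pi) => b Pb maxb.
exists b => a; apply/best_amongP/eqP => [[Pa maxa]|->] //.
by apply/injX/le_anti; rewrite maxa // andbT; apply: maxb.
Qed.

Definition opt_agent {R : realFieldType} {n : nat} (X : 'I_n.+1 -> R)
    (sg : 'S_n.+1) : pred 'I_n.+1 :=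
  best_among X (fun c => (sg seller <= sg c)%N).

Definition record {R : realFieldType} {n : nat} (X : 'I_n.+1 -> R)
    (sg : 'S_n.+1) (a : 'I_n.+1) : bool :=
  best_among X (fun c => (sg c <= sg a)%N) a.

Lemma welfare_le_offline_opt (R : realFieldType) (n : nat) (X : 'I_n.+1 -> R)
    (sg : 'S_n.+1) a :
  (sg seller <= sg a)%N -> X a <= offline_opt X sg^-1%g.
Proof.
move=> Sa.
suff [d /eqP da] : exists d, final_holder sg^-1%g d == Some a.
  rewrite -[X a]/(welfare X (Some a)) -da.
  exact: (le_bigmax _ (fun d => welfare X (final_holder sg^-1%g d))).
case: (eqVneq a seller) => [->|aS].
  by exists [ffun=> false]; rewrite final_holder_seller ffunE.
(* Trade with the seller and with [a] only. *)
exists [ffun t => (t == sg seller) || (t == sg a)].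
rewrite final_holder_buyer // !ffunE !eqxx orbT /=.
have -> : (sg seller < sg a)%N.
  by rewrite ltn_neqAle Sa andbT (inj_eq val_inj) (inj_eq perm_inj) eq_sym.
apply/forallP => c; apply/implyP => /andP[Sc ca]; rewrite ffunE negb_or.
by rewrite -!(inj_eq val_inj) neq_ltn Sc orbT neq_ltn ca.
Qed.

(** Any run ends with the intermediary, worth 0, or with an agent arriving no earlier than the
    seller; the best such agent is attainable. *)
Lemma offline_optE (R : realFieldType) (n : nat) (X : 'I_n.+1 -> R)
    (sg : 'S_n.+1) :
  admissible X ->
  offline_opt X sg^-1%g = \sum_a X a * (opt_agent X sg a)%:R.
Proof.
move=> [injX X0].
have [b bE] : exists b, opt_agent X sg =1 pred1 b.
  exact: (@best_among_ex _ _ X _ seller).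
rewrite (bigD1 b) //= bE /= eqxx mulr1 big1 ?addr0 => [|a /negPf ab]; last first.
  by rewrite bE /= ab mulr0.
have /best_amongP[Sb maxb] : opt_agent X sg b by rewrite bE /=.
apply/le_anti; rewrite welfare_le_offline_opt // andbT.
apply: bigmax_le => // d _; case E: (final_holder _ _) => [a|] //=.
apply: maxb; case: (eqVneq a seller) => [->|aS] //.
by move/eqP: E; rewrite final_holder_buyer // => /and4P[_ /ltnW].
Qed.

(** * Who gets the item under the algorithm *)

(** Twice the probability, for a fixed order, that [a] ends up with the item; doubling keeps the
    counting in [nat]. *)
Definition srt_count {R : realFieldType} {n : nat} (X : 'I_n.+1 -> R)
    (sg : 'S_n.+1) (a : 'I_n.+1) : nat :=
  \sum_(coin : bool)
    (final_holder sg^-1%g (srt_decision X sg^-1%g coin) == Some a).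

Lemma welfareE (R : realFieldType) (n : nat) (X : 'I_n.+1 -> R) h :
  welfare X h = \sum_a X a * (h == Some a)%:R.
Proof.
case: h => [b|] /=; last by rewrite big1 // => a _; rewrite mulr0.
rewrite (bigD1 b) //= eqxx mulr1 big1 ?addr0 // => a /negPf ab.
by rewrite (inj_eq Some_inj) eq_sym ab mulr0.
Qed.

Lemma srt_welfareE (R : realFieldType) (n : nat) (X : 'I_n.+1 -> R)
    (sg : 'S_n.+1) :
  srt_welfare X sg^-1%g true + srt_welfare X sg^-1%g false =
  \sum_a X a * (srt_count X sg a)%:R.
Proof.
rewrite /srt_welfare !welfareE -big_split; apply: eq_bigr => a _ /=.
by rewrite -mulrDr -natrD /srt_count big_bool.
Qed.

Lemma highest_so_farE (R : realFieldType) (n : nat) (X : 'I_n.+1 -> R)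
    (sg : 'S_n.+1) a :
  highest_so_far X sg^-1%g (sg a) = record X sg a.
Proof.
apply/forallP/best_amongP => [high|[_ high] u].
  split=> // c ca; have /implyP := high (sg c); rewrite !permK; exact.
rewrite permK; apply/implyP => ua; apply: high; by rewrite permKV.
Qed.

Lemma srt_decisionE (R : realFieldType) (n : nat) (X : 'I_n.+1 -> R)
    (sg : 'S_n.+1) coin a :
  srt_decision X sg^-1%g coin (sg a) =
  if a == seller then ~~ record X sg a || coin else record X sg a.
Proof. by rewrite ffunE permK highest_so_farE. Qed.

Lemma srt_count_seller (R : realFieldType) (n : nat) (X : 'I_n.+1 -> R)
    (sg : 'S_n.+1) :
  srt_count X sg seller = record X sg seller.
Proof.
rewrite /srt_count big_bool !final_holder_seller !srt_decisionE eqxx.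
by case: record.
Qed.

Definition best_before {R : realFieldType} {n : nat} (X : 'I_n.+1 -> R)
    (sg : 'S_n.+1) (a : 'I_n.+1) : pred 'I_n.+1 :=
  best_among X (fun c => (sg c < sg a)%N).

(* The item reaches the record a exactly when it was bought and no record fell
   strictly between the seller and a, i.e. when the best agent b before a did
   not arrive after the seller; if b is the seller, only one coin buys. *)
Lemma srt_count_buyer (R : realFieldType) (n : nat) (X : 'I_n.+1 -> R)
    (sg : 'S_n.+1) a b :
  injective X -> (sg seller < sg a)%N -> record X sg a -> best_before X sg a b ->
  srt_count X sg a = ((sg b <= sg seller) + (sg b < sg seller))%N.
Proof.
move=> injX Sa reca /best_amongP[ba maxb].
have aS : a != seller by apply: contraTneq Sa => ->; rewrite ltnn.
rewrite /srt_count big_bool !final_holder_buyer // !srt_decisionE eqxx.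
rewrite (negPf aS) Sa reca /= orbT orbF.
have freeE coin : [forall c, (sg seller < sg c < sg a)%N ==>
    ~~ srt_decision X sg^-1%g coin (sg c)] = (sg b <= sg seller)%N.
  apply/forallP/idP => [free|bS c].
    rewrite leqNgt; apply/negP => Sb; have := free b; rewrite Sb ba /=.
    rewrite srt_decisionE; case: eqVneq Sb => [->|_ _]; first by rewrite ltnn.
    suff -> : record X sg b by [].
    by apply/best_amongP; split=> // c cb; apply: maxb; apply: leq_ltn_trans ba.
  apply/implyP => /andP[Sc ca]; rewrite srt_decisionE.
  case: eqVneq Sc => [->|_ Sc]; first by rewrite ltnn.
  have bc := leq_ltn_trans bS Sc.
  apply/negP => /best_amongP[_ /(_ b (ltnW bc)) Xbc].
  have cb : c = b by apply/injX/le_anti; rewrite Xbc maxb.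
  by rewrite cb ltnn in bc.
(* If [b] precedes the seller, the seller is no record and both coins buy; if [b] follows, neither
   coin gives [a] the item; if [b] is the seller, it is a record and only [true] buys. *)
rewrite !freeE /=; case: (ltngtP (sg b) (sg seller)) => [bS||bS] /=.
- rewrite (_ : record _ _ _ = false) //; apply/negP => /best_amongP[_].
  move=> /(_ b (ltnW bS)) XbS.
  have Sb : seller = b by apply/injX/le_anti; rewrite XbS maxb.
  by rewrite Sb ltnn in bS.
- by rewrite andbF.
move/val_inj/perm_inj: bS => bS; rewrite -bS (_ : record _ _ _) //.
by apply/best_amongP; split=> // c cb; apply: maxb; apply: leq_ltn_trans ba.
Qed.

Lemma srt_count_eq0 (R : realFieldType) (n : nat) (X : 'I_n.+1 -> R)
    (sg : 'S_n.+1) a :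
  a != seller -> ~~ ((sg seller < sg a)%N && record X sg a) ->
  srt_count X sg a = 0%N.
Proof.
move=> aS; rewrite /srt_count big_bool !final_holder_buyer // !srt_decisionE.
rewrite (negPf aS) eqxx.
by case: (_ < _)%N => /=; [move/negPf=> -> |]; rewrite ?andbF.
Qed.

(* Exchanging the arrival times of the seller and of the best agent before a
   makes the two cases of [srt_count_buyer] compensate each other. *)
Lemma sum_srt_count_buyer (R : realFieldType) (n : nat) (X : 'I_n.+1 -> R) a :
  injective X -> a != seller ->
  (\sum_(sg : 'S_n.+1) srt_count X sg a =
   \sum_(sg : 'S_n.+1) ((sg seller < sg a) && record X sg a))%N.
Proof.
move=> injX aS.
pose C (sg : 'S_n.+1) := (sg seller < sg a)%N && record X sg a.
(* On [C] the seller arrives before [a], so exactly one [b] is best before [a]. *)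
have partC (F : 'S_n.+1 -> nat) : (\sum_(sg | C sg) F sg =
    \sum_b \sum_(sg | C sg && best_before X sg a b) F sg)%N.
  rewrite (exchange_big_dep C) /=; last by move=> b sg _ /andP[].
  apply: eq_bigr => sg Csg; have /andP[Sa _] := Csg.
  have [b bE] : exists b, best_before X sg a =1 pred1 b.
    exact: (@best_among_ex _ _ X _ seller).
  by rewrite (eq_bigl (pred1 b)) ?big_pred1_eq // => c; rewrite Csg bE.
rewrite [RHS](eq_bigr (fun sg => if C sg then 1 else 0)%N); last first.
  by move=> sg _; rewrite -/(C sg); case: (C sg).
rewrite (bigID C) /= [X in (_ + X)%N]big1 ?addn0; last first.
  by move=> sg; apply: srt_count_eq0.
rewrite -big_mkcond /= !partC; apply: eq_bigr => b _.
rewrite (eq_bigr (fun sg : 'S_n.+1 =>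
  (sg b <= sg seller) + (sg b < sg seller))%N); last first.
  by move=> sg /andP[/andP[Sa reca] bb]; apply: srt_count_buyer.
rewrite big_split /=.
(* Both exchanged agents arrive before [a], so the set of agents before [a] is unchanged. *)
have swapE (sg : 'S_n.+1) : C sg -> best_before X sg a b ->
    C (tperm seller b * sg)%g && best_before X (tperm seller b * sg)%g a b.
  move=> /andP[Sa /best_amongP[_ maxa]] /best_amongP[ba maxb].
  have ab : a != b by apply: contraTneq ba => ->; rewrite ltnn.
  have ltE c : (sg (tperm seller b c) < sg a)%N = (sg c < sg a)%N.
    by case: tpermP => [->|->|]; rewrite ?Sa ?ba.
  have leE c : (sg (tperm seller b c) <= sg a)%N = (sg c <= sg a)%N.
    by case: tpermP => [->|->|]; rewrite ?(ltnW Sa) ?(ltnW ba).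
  have aE : (tperm seller b * sg)%g a = sg a.
    by rewrite permM tpermD // eq_sym.
  rewrite /C aE permM ltE Sa /=; apply/andP; split; apply/best_amongP.
    by rewrite aE; split=> // c; rewrite permM leE; apply: maxa.
  by rewrite aE permM ltE; split=> // c; rewrite permM ltE; apply: maxb.
(* Reindexing only the first sum turns its condition into [sg seller <= sg b], the complement of the
   condition in the second. *)
rewrite (reindex_inj (mulgI (tperm seller b))) /=.
rewrite [X in (X + _)%N](eq_bigl (fun sg => C sg && best_before X sg a b));
  last first.
  move=> sg; apply/idP/idP => /andP[]; last exact: swapE.
  by move=> /swapE H /H; rewrite mulgA tperm2 mul1g.
rewrite -big_split /=; apply: eq_bigr => sg _.
by rewrite !permM tpermL tpermR leqNgt; case: (_ < _)%N.
Qed.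

(** * Time reversal, from records to offline choices *)

Definition rev_perm (n : nat) : 'S_n := perm (@rev_ord_inj n).

Lemma leq_rev_perm (n : nat) (i j : 'I_n) :
  (rev_perm n i <= rev_perm n j)%N = (j <= i)%N.
Proof. by rewrite !permE /= leq_sub2lE // ltnS. Qed.

Lemma sum_record_opt_seller (R : realFieldType) (n : nat) (X : 'I_n.+1 -> R) :
  (\sum_(sg : 'S_n.+1) record X sg seller =
   \sum_(sg : 'S_n.+1) opt_agent X sg seller)%N.
Proof.
rewrite (reindex_inj (mulIg (rev_perm n.+1))); apply: eq_bigr => sg _ /=.
congr nat_of_bool; apply/best_amongP/best_amongP => -[_ max]; split=> // c Sc;
  by apply: max; move: Sc; rewrite !permM leq_rev_perm.
Qed.

(** Reversal turns the agents up to [a] into those from [a] on, and the exchange turns these into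
    the agents from the seller on. That set contains both [a] and the seller, so exchanging them
    preserves it. *)
Lemma sum_record_opt_buyer (R : realFieldType) (n : nat) (X : 'I_n.+1 -> R) a :
  a != seller ->
  (\sum_(sg : 'S_n.+1) ((sg seller < sg a) && record X sg a) =
   \sum_(sg : 'S_n.+1) opt_agent X sg a)%N.
Proof.
move=> aS.
rewrite (reindex_inj (mulIg (rev_perm n.+1))) /=.
rewrite (reindex_inj (mulgI (tperm seller a))) /=.
apply: eq_bigr => sg _; congr nat_of_bool.
have neq : sg seller != sg a by rewrite (inj_eq perm_inj) eq_sym.
apply/andP/best_amongP.
  rewrite !permM tpermL tpermR ltnNge leq_rev_perm -ltnNge.
  move=> [Sa /best_amongP[_ max]]; split=> [|c Sc]; first exact: ltnW.
  case: (eqVneq c a) => [->|ca] //.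
  apply: max; rewrite !permM leq_rev_perm tpermR.
  by case: tpermP => [_|_|_ _]; rewrite ?(ltnW Sa).
move=> [Sa max]; rewrite !permM tpermL tpermR ltnNge leq_rev_perm -ltnNge.
rewrite ltn_neqAle Sa andbT; split=> //.
apply/best_amongP; split=> // c; rewrite !permM leq_rev_perm tpermR.
case: tpermP => [->|->|_ _] //; first by move=> _; apply: max.
exact: max.
Qed.

Lemma sum_srt_count (R : realFieldType) (n : nat) (X : 'I_n.+1 -> R) a :
  injective X ->
  (\sum_(sg : 'S_n.+1) srt_count X sg a =
   \sum_(sg : 'S_n.+1) opt_agent X sg a)%N.
Proof.
move=> injX; case: (eqVneq a seller) => [->|aS].
  rewrite -sum_record_opt_seller; apply: eq_bigr => sg _.
  exact: srt_count_seller.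
by rewrite sum_srt_count_buyer // sum_record_opt_buyer.
Qed.

(** * The ratio *)

Lemma SRT_half_OPT (R : realFieldType) (n : nat) (X : 'I_n.+1 -> R) :
  admissible X -> SRT X = OPT X / 2.
Proof.
move=> admX; have [injX _] := admX.
rewrite /SRT /OPT /uniform_order_mean -mulr_suml mulrAC; congr (_ / _ / _).
(* Sum over arrival times instead of orders, then compare agent by agent. *)
rewrite (reindex_inj invg_inj) [RHS](reindex_inj invg_inj) /=.
under eq_bigr do rewrite srt_welfareE.
under [RHS]eq_bigr do rewrite offline_optE //.
rewrite exchange_big [RHS]exchange_big /=; apply: eq_bigr => a _.
by rewrite -!mulr_sumr -!natr_sum sum_srt_count.
Qed.

Lemma OPT_gt0 (R : realFieldType) (n : nat) (X : 'I_n.+1 -> R) :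
  (0 < n)%N -> admissible X -> 0 < OPT X.
Proof.
move=> n0 [injX X0].
have [a Xa] : exists a, 0 < X a.
  have neq : X ord0 != X seller.
    by rewrite (inj_eq injX) -(inj_eq val_inj) /= neq_ltn n0.
  have [X00|X00] := eqVneq (X ord0) 0.
    by exists seller; rewrite lt_def X0 andbT eq_sym -X00.
  by exists ord0; rewrite lt_def X00 X0.
rewrite /OPT /uniform_order_mean divr_gt0 ?ltr0n ?fact_gt0 //.
(* Here the seller arrives first, so the optimum is at least [X a]. *)
pose sg : 'S_n.+1 := tperm seller ord0.
rewrite (bigD1 sg^-1%g) //=; apply: ltr_pwDl.
  by apply: lt_le_trans Xa _; apply: welfare_le_offline_opt; rewrite tpermL.
apply: sumr_ge0 => s _; apply: bigmax_ge_id.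
Qed.

Theorem theorem4p1 (R : realFieldType) (n : nat) (hn : (0 < n)%N) :
  is_weak_competitive_ratio (@SRT R n) 2.
Proof.
have SRT_gt0 (X : 'I_n.+1 -> R) : admissible X -> 0 < SRT X.
  by move=> admX; rewrite SRT_half_OPT // divr_gt0 ?OPT_gt0.
have ratio (X : 'I_n.+1 -> R) : admissible X -> OPT X / SRT X = 2.
  move=> admX; rewrite SRT_half_OPT // invfM invrK mulrA divff ?mul1r //.
  by rewrite gt_eqF // OPT_gt0.
split=> [|X admX]; last by split; [apply: SRT_gt0 | rewrite ratio].
(* Any admissible vector attains the ratio; [0, 1, ..., n] is a concrete one. *)
have admN : admissible (fun i : 'I_n.+1 => (i : nat)%:R : R).
  split=> [i j /eqP|i]; last exact: ler0n.
  by rewrite eqr_nat => /eqP/val_inj.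
by exists (fun i : 'I_n.+1 => (i : nat)%:R); split; [|apply: SRT_gt0|apply: ratio].
Qed.
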